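(* Let $k$ be an algebraically closed field of characteristic zero. Let $n\geq 1$ and $d\ge 1$ be such that the apolar algebra of a general polynomial in $P_{\le d}$, where $P=k_{dp}[x_1,\dots,x_n]$, is canonically graded (i.e. there is a non-empty Zariski open subset $U$ of the affine space $P_{\le d}$ such that $\operatorname{Apolar}(f)\simeq\operatorname{gr}\operatorname{Apolar}(f)$ for all $f\in U$). Then $(n,d)$ belongs to the following list: 1. $d\le 4$ and $n$ arbitrary, 2. $d=5$ and $n\le 6$, 3. $d=6$ and $n=2$, 4. $d$ arbitrary and $n=1$.
   Context: Let $S=k[[\alpha_1,\dots,\alpha_n]]$. $P=k_{dp}[x_1,\dots,x_n]$ is the divided power ring, with $k$-basis the monomials $\mathbf x^{[\mathbf a]}$, $\mathbf a\in\mathbb N_0^n$ (of degree $\sum a_i$), $P_{\le d}$ is the span of those of degree at most $d$, and $S$ acts on $P$ by contraction: $\alpha^{\mathbf a}\lrcorner \mathbf x^{[\mathbf b]}=\mathbf x^{[\mathbf b-\mathbf a]}$ if $\mathbf b\ge\mathbf a$ coordinatewise and $0$ otherwise. (In characteristic zero $P$ is isomorphic to the polynomial ring $k[x_1,\dots,x_n]$ with $\alpha_i$ acting as $\partial/\partial x_i$, via $\mathbf x^{[\mathbf a]}\mapsto\mathbf x^{\mathbf a}/\mathbf a!$.) For $f\in P$, $\operatorname{Apolar}(f)=S/\operatorname{Ann}(f)$ with $\operatorname{Ann}(f)=\{\sigma\in S:\sigma\lrcorner f=0\}$. For a local algebra $(A,\mathfrak m_A)$, $\operatorname{gr}A=\bigoplus_{i}\mathfrak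 m_A^i/\mathfrak m_A^{i+1}$. *)

(* Defs.v *)
From HB Require Import structures.
From mathcomp Require Import all_boot all_order all_algebra.
From mathcomp Require Import generic_quotient.
From mathcomp Require Import boolp.
From mathcomp Require Import freeg mpoly.

Set Implicit Arguments.
Unset Strict Implicit.
Unset Printing Implicit Defensive.

Import GRing.Theory.
Local Open Scope ring_scope.
Local Open Scope quotient_scope.

(* The exponents a with a <= m coordinatewise. *)
Definition mnm_below n (m : 'X_{1..n}) : seq 'X_{1..n} :=
  [seq a <- [seq bmnm b | b : 'X_{1..n < (mdeg m).+1}] | (a <= m)%MM].

Section Below.
Context {n : nat}.
Implicit Types m a b c : 'X_{1..n}.

Lemma lem_mdeg a m : (a <= m)%MM -> (mdeg a <= mdeg m)%N.
Proof. by move=> /submK <-; rewrite mdegD leq_addl. Qed.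

Lemma mem_below m a : (a \in mnm_below m) = (a <= m)%MM.
Proof.
rewrite mem_filter andbC; case: (boolP (a <= m)%MM) => [am|]; last by rewrite andbF.
rewrite andbT; have h : (mdeg a < (mdeg m).+1)%N by rewrite ltnS lem_mdeg.
by apply/mapP; exists (BMultinom h); rewrite ?mem_enum.
Qed.

Lemma uniq_below m : uniq (mnm_below m).
Proof.
apply: filter_uniq; rewrite map_inj_uniq ?enum_uniq //; exact: val_inj.
Qed.

Lemma subKm m a : (a <= m)%MM -> (m - (m - a))%MM = a.
Proof.
by move=> /mnm_lepP am; apply/mnmP => i; rewrite !mnmBE subKn.
Qed.

Lemma lem_sub_add m a b : (b <= m)%MM -> (a <= m - b)%MM = (b + a <= m)%MM.
Proof.
move=> /mnm_lepP bm; apply/mnm_lepP/mnm_lepP => h i; move: (h i) (bm i);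
  rewrite !mnmE => + bi; by rewrite leq_subRL.
Qed.

Lemma below_rev m : perm_eq (mnm_below m) [seq (m - a)%MM | a <- mnm_below m].
Proof.
apply: uniq_perm; rewrite ?uniq_below //.
  rewrite map_inj_in_uniq ?uniq_below // => a b.
  by rewrite !mem_below => am bm e; rewrite -(subKm am) -(subKm bm) e.
move=> a; rewrite mem_below; apply/idP/mapP => [am|[b _ ->]]; last exact: lem_subr.
by exists (m - a)%MM; rewrite ?mem_below ?lem_subr ?subKm.
Qed.

Lemma below_sub m a : (a <= m)%MM ->
  perm_eq (mnm_below a) [seq b <- mnm_below m | (b <= a)%MM].
Proof.
move=> am; apply: uniq_perm; rewrite ?uniq_below ?(filter_uniq _ (uniq_below m)) // => b.
rewrite mem_below mem_filter mem_below; case: (boolP (b <= a)%MM) => //= ba.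
by rewrite (lepm_trans ba am).
Qed.

Lemma below_shift m b : (b <= m)%MM ->
  perm_eq [seq a <- mnm_below m | (b <= a)%MM]
          [seq (b + c)%MM | c <- mnm_below (m - b)].
Proof.
move=> bm; apply: uniq_perm; rewrite ?(filter_uniq _ (uniq_below m)) //.
  by rewrite map_inj_uniq ?uniq_below //; exact: addmI.
move=> a; rewrite mem_filter mem_below; apply/andP/mapP => [[ba am]|[c + ->]].
  exists (a - b)%MM; last by rewrite addmC submK.
  by rewrite mem_below lem_sub_add // addmC submK.
by rewrite mem_below lem_sub_add // => ->; rewrite lem_addr.
Qed.

Lemma sum_below_assoc (V : nmodType)
    (F : 'X_{1..n} -> 'X_{1..n} -> 'X_{1..n} -> V) m :
  \sum_(a <- mnm_below m) \sum_(b <- mnm_below a) F b (a - b)%MM (m - a)%MM =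
  \sum_(b <- mnm_below m) \sum_(c <- mnm_below (m - b))
     F b c (m - b - c)%MM.
Proof.
transitivity (\sum_(a <- mnm_below m) \sum_(b <- mnm_below m | (b <= a)%MM)
    F b (a - b)%MM (m - a)%MM).
  rewrite !big_seq; apply: eq_bigr => a; rewrite mem_below => am.
  by rewrite (perm_big _ (below_sub am)) big_filter.
rewrite (exchange_big_dep xpredT) //= !big_seq; apply: eq_bigr => b.
rewrite mem_below => bm; rewrite -big_filter (perm_big _ (below_shift bm)).
rewrite big_map; apply: eq_bigr => c _.
by rewrite submDA addmC addmK addmC.
Qed.

End Below.

(* R[[X_1, ..., X_n]]: a series is its family of coefficients. *)
Record mseries n (R : Type) := MSeries { mscoef :> 'X_{1..n} -> R }.

HB.instance Definition _ n R := [isNew for @mscoef n R].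
HB.instance Definition _ n (R : choiceType) := [Choice of mseries n R by <:].

Section MSeries.
Context (n : nat) (R : comPzRingType).
Local Notation S := (mseries n R).
Implicit Types p q r : S.

Lemma mseriesP p q : (forall m, p m = q m) <-> p = q.
Proof.
by split=> [e|->//]; apply: val_inj; apply/funext.
Qed.

Definition ms_const (c : R) : S := MSeries (fun m => if m == 0%MM then c else 0).
Definition ms_opp p : S := MSeries (fun m => - p m).
Definition ms_add p q : S := MSeries (fun m => p m + q m).
Definition ms_mul p q : S :=
  MSeries (fun m => \sum_(a <- mnm_below m) p a * q (m - a)%MM).

Fact ms_addA : associative ms_add.
Proof. by move=> p q r; apply/mseriesP => m /=; rewrite addrA. Qed.
Fact ms_addC : commutative ms_add.
Proof. by move=> p q; apply/mseriesP => m /=; rewrite addrC. Qed.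
Fact ms_add0 : left_id (ms_const 0) ms_add.
Proof. by move=> p; apply/mseriesP => m /=; rewrite if_same add0r. Qed.
Fact ms_addN : left_inverse (ms_const 0) ms_opp ms_add.
Proof. by move=> p; apply/mseriesP => m /=; rewrite if_same addNr. Qed.

HB.instance Definition _ :=
  GRing.isZmodule.Build S ms_addA ms_addC ms_add0 ms_addN.

Fact ms_mulC : commutative ms_mul.
Proof.
move=> p q; apply/mseriesP => m /=.
rewrite (perm_big _ (below_rev m)) big_map !big_seq; apply: eq_bigr => a.
by rewrite mem_below => am; rewrite subKm // mulrC.
Qed.

Fact ms_mulA : associative ms_mul.
Proof.
move=> p q r; apply/mseriesP => m /=.
under eq_bigr do rewrite mulr_sumr.
under [RHS]eq_bigr do rewrite mulr_suml.
rewrite (sum_below_assoc (fun a b c => p a * q b * r c)).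
by do 2!apply: eq_bigr => ? _; rewrite mulrA.
Qed.

Lemma ms_const_mulE c p m : ms_mul (ms_const c) p m = c * p m.
Proof.
rewrite /= (bigD1_seq 0%MM) ?uniq_below ?mem_below //=; last first.
  by apply/mnm_lepP => i; rewrite mnm0E.
rewrite eqxx subm0 big1 ?addr0 // => a /negbTE ->.
by rewrite mul0r.
Qed.

Fact ms_mul1 : left_id (ms_const 1) ms_mul.
Proof. by move=> p; apply/mseriesP => m; rewrite ms_const_mulE mul1r. Qed.

Fact ms_mulDl : left_distributive ms_mul ms_add.
Proof.
move=> p q r; apply/mseriesP => m /=; rewrite -big_split.
by apply: eq_bigr => a _; rewrite mulrDl.
Qed.

HB.instance Definition _ :=
  GRing.Zmodule_isComPzRing.Build S ms_mulA ms_mulC ms_mul1 ms_mulDl.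

Lemma ms0E m : (0 : S) m = 0. Proof. exact: if_same. Qed.
Lemma ms1E m : (1 : S) m = if m == 0%MM then 1 else 0. Proof. by []. Qed.
Lemma msNE p m : (- p) m = - p m. Proof. by []. Qed.
Lemma msDE p q m : (p + q) m = p m + q m. Proof. by []. Qed.
Lemma msBE p q m : (p - q) m = p m - q m. Proof. by []. Qed.
Lemma msME p q m : (p * q) m = \sum_(a <- mnm_below m) p a * q (m - a)%MM.
Proof. by []. Qed.

Fact ms_const_zmod : zmod_morphism ms_const.
Proof.
move=> x y; apply/mseriesP => m; rewrite msBE /=.
by case: eqP; rewrite ?subr0.
Qed.
HB.instance Definition _ := GRing.isZmodMorphism.Build R S ms_const ms_const_zmod.

Fact ms_const_monoid : monoid_morphism ms_const.
Proof.
split=> // x y; apply/mseriesP => m.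
by rewrite [RHS]ms_const_mulE /=; case: eqP; rewrite ?mulr0.
Qed.
HB.instance Definition _ := GRing.isMonoidMorphism.Build R S ms_const ms_const_monoid.

End MSeries.

(* Ideals of a commutative ring, not necessarily proper.  The ideal quotients of
   MathComp require proper ideals, which excludes Ann(0). *)
Record ideal (R : comPzRingType) := Ideal {
  ideal_set :> R -> Prop;
  ideal0 : ideal_set 0;
  idealD : forall x y, ideal_set x -> ideal_set y -> ideal_set (x + y);
  idealM : forall a x, ideal_set x -> ideal_set (a * x)
}.

Section IdealTheory.
Context (R : comPzRingType).
Implicit Types (I J : ideal R) (X : R -> Prop).

Lemma idealN I x : I x -> I (- x).
Proof. by rewrite -mulN1r; exact: idealM. Qed.

Lemma ideal_sum I (T : eqType) (s : seq T) (F : T -> R) :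
  (forall x, x \in s -> I (F x)) -> I (\sum_(x <- s) F x).
Proof.
move=> h; rewrite big_seq; elim/big_ind: _ => //; [exact: ideal0 | exact: idealD].
Qed.

(* The smallest ideal containing X. *)
Definition ideal_gen_set X : R -> Prop :=
  fun x => forall I, (forall y, X y -> I y) -> I x.

Fact ideal_gen0 X : ideal_gen_set X 0.
Proof. by move=> I _; exact: ideal0. Qed.
Fact ideal_genD X x y :
  ideal_gen_set X x -> ideal_gen_set X y -> ideal_gen_set X (x + y).
Proof. by move=> hx hy I XI; apply: idealD; [exact: hx | exact: hy]. Qed.
Fact ideal_genM X a x : ideal_gen_set X x -> ideal_gen_set X (a * x).
Proof. by move=> hx I XI; apply: idealM; exact: hx. Qed.

Definition ideal_gen X : ideal R :=
  Ideal (@ideal_gen0 X) (@ideal_genD X) (@ideal_genM X).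

Lemma ideal_gen_sub X I : (forall y, X y -> I y) -> forall x, ideal_gen X x -> I x.
Proof. by move=> XI x; apply. Qed.

Lemma ideal_gen_mem X x : X x -> ideal_gen X x.
Proof. by move=> Xx I; apply. Qed.

Definition ideal_whole : ideal R :=
  @Ideal R (fun _ => True) Logic.I (fun _ _ _ _ => Logic.I) (fun _ _ _ => Logic.I).

Definition ideal_mul I J : ideal R :=
  ideal_gen (fun z => exists x y, [/\ I x, J y & z = x * y]).

Definition ideal_pow I i : ideal R := iter i (ideal_mul I) ideal_whole.

Lemma ideal_pow_le I i x : ideal_pow I i.+1 x -> ideal_pow I i x.
Proof. by apply: ideal_gen_sub => z [a [b [_ hb ->]]]; exact: idealM. Qed.

Fact ideal_colon0 I y : I (0 * y). Proof. by rewrite mul0r; exact: ideal0. Qed.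
Fact ideal_colonD I y u v : I (u * y) -> I (v * y) -> I ((u + v) * y).
Proof. by rewrite mulrDl; exact: idealD. Qed.
Fact ideal_colonM I y a u : I (u * y) -> I (a * u * y).
Proof. by rewrite -mulrA; exact: idealM. Qed.
Definition ideal_colon I y : ideal R :=
  @Ideal R (fun x => I (x * y)) (@ideal_colon0 I y) (@ideal_colonD I y)
    (@ideal_colonM I y).

Lemma ideal_powD I i j x y :
  ideal_pow I i x -> ideal_pow I j y -> ideal_pow I (i + j) (x * y).
Proof.
elim: i x => [|i IH] x hx hy; first exact: idealM.
apply: (ideal_gen_sub (I := ideal_colon (ideal_pow I (i.+1 + j)) y)) hx.
move=> z [a [b [Ia hb ->]]]; rewrite /= -mulrA; apply: ideal_gen_mem.
by exists a, (b * y); split=> //; exact: IH.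
Qed.

Definition ideal_pred I : {pred R} := fun x => `[< I x >].

Fact ideal_pred_zmod I : zmod_closed (ideal_pred I).
Proof.
split; first exact/asboolP/ideal0.
by move=> x y /asboolP hx /asboolP hy; apply/asboolP/idealD => //; exact: idealN.
Qed.
HB.instance Definition _ I :=
  GRing.isZmodClosed.Build R (ideal_pred I) (ideal_pred_zmod I).

End IdealTheory.

(* The quotient ring R / I. *)
Definition quotr (R : comPzRingType) (I : ideal R) : Type :=
  Quotient.quot (ideal_pred I).

Section QuotientRing.
Context (R : comPzRingType) (I : ideal R).
Local Notation Q := (quotr I).

HB.instance Definition _ := GRing.Zmodule.on Q.

Definition quotr_pi (x : R) : Q := \pi_(Quotient.quot (ideal_pred I)) x.
Definition quotr_mul (x y : Q) : Q := quotr_pi (repr x * repr y).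

Lemma quotr_repr (x : Q) : quotr_pi (repr x) = x.
Proof. exact: reprK. Qed.

Lemma quotr_eqP x y : quotr_pi x = quotr_pi y <-> I (x - y).
Proof.
split=> [/eqP|h]; last first.
  by apply/eqP; rewrite -[_ == _]Quotient.idealrBE; apply/asboolP.
by rewrite -[_ == _]Quotient.idealrBE => /asboolP.
Qed.

Lemma quotr_piM x y : quotr_pi (x * y) = quotr_mul (quotr_pi x) (quotr_pi y).
Proof.
apply/quotr_eqP; set x' := repr _; set y' := repr _.
have hx : I (x - x') by apply/quotr_eqP; rewrite quotr_repr.
have hy : I (y - y') by apply/quotr_eqP; rewrite quotr_repr.
have -> : x * y - x' * y' = y * (x - x') + x' * (y - y').
  by rewrite !mulrBr (mulrC y) (mulrC y) addrA subrK.
by apply: idealD; exact: idealM.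
Qed.

Fact quotr_pi_zmod : zmod_morphism quotr_pi.
Proof. exact: raddfB. Qed.
HB.instance Definition _ := GRing.isZmodMorphism.Build R Q quotr_pi quotr_pi_zmod.

Fact quotr_mulA : associative quotr_mul.
Proof.
move=> x y z; rewrite -[x]quotr_repr -[y]quotr_repr -[z]quotr_repr.
by rewrite -!quotr_piM mulrA.
Qed.
Fact quotr_mulC : commutative quotr_mul.
Proof. by move=> x y; rewrite /quotr_mul mulrC. Qed.
Fact quotr_mul1 : left_id (quotr_pi 1) quotr_mul.
Proof. by move=> x; rewrite -[x]quotr_repr -quotr_piM mul1r. Qed.
Fact quotr_mulDl : left_distributive quotr_mul +%R.
Proof.
move=> x y z; rewrite -[x]quotr_repr -[y]quotr_repr -[z]quotr_repr.
by rewrite -raddfD -!quotr_piM mulrDl raddfD.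
Qed.

HB.instance Definition _ :=
  GRing.Zmodule_isComPzRing.Build Q quotr_mulA quotr_mulC quotr_mul1 quotr_mulDl.

Fact quotr_pi_monoid : monoid_morphism quotr_pi.
Proof. by split=> // x y; exact: quotr_piM. Qed.
HB.instance Definition _ := GRing.isMonoidMorphism.Build R Q quotr_pi quotr_pi_monoid.

End QuotientRing.

(* Commutative k-algebras, presented as rings under k.  MathComp's [comAlgType]
   excludes the zero ring, which is Apolar(0). *)
Record calg (k : comPzRingType) := CAlg {
  calg_ring :> comPzRingType;
  calg_map : {rmorphism k -> calg_ring}
}.

Definition calg_isom (k : comPzRingType) (A B : calg k) : Prop :=
  exists phi : {rmorphism A -> B},
    bijective phi /\ forall c, phi (calg_map A c) = calg_map B c.

(* The associated graded ring.  m_A is the ideal of the non-units of the local ring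
   A.  Collecting all degrees, gr A is the quotient of
     (+)_i m_A^i = {p in A[T] | p_i in m_A^i for all i}
   by the ideal (+)_i m_A^(i+1); A[T] is seen inside A[[T]], whose exponents are
   the m : 'X_{1..1}, with i = mdeg m.  For A = 0 this gives gr A = 0. *)
Section AssociatedGraded.
Context (k : comPzRingType) (A : calg k).

Definition max_ideal : ideal A := ideal_gen (fun x : A => ~ exists y, x * y = 1).

Definition rees_pred : {pred mseries 1 A} := fun p =>
  `[< (forall m, ideal_pow max_ideal (mdeg m) (p m)) /\
      (exists N, forall m, (N <= mdeg m)%N -> p m = 0) >].

Fact rees_const c : ms_const 1 c \in rees_pred.
Proof.
apply/asboolP; split=> [m|].
  by rewrite /=; case: eqP => [->|_]; [rewrite mdeg0|exact: ideal0].
by exists 1%N => m; rewrite lt0n mdeg_eq0 /= => /negbTE ->.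
Qed.

Fact rees_subring : subring_closed rees_pred.
Proof.
split; first exact: rees_const.
  move=> p q /asboolP[hp [N hN]] /asboolP[hq [M hM]]; apply/asboolP; split.
    by move=> m; rewrite msBE; apply: idealD => //; exact: idealN.
  exists (maxn N M) => m; rewrite geq_max => /andP[Nm Mm].
  by rewrite msBE hN // hM // subr0.
move=> p q /asboolP[hp [N hN]] /asboolP[hq [M hM]]; apply/asboolP; split=> [m|].
  rewrite msME; apply: ideal_sum => a; rewrite mem_below => am.
  by rewrite -{1}(submK am) addmC mdegD; exact: ideal_powD.
exists (N + M)%N => m; rewrite msME big_seq => h; apply: big1 => a.
rewrite mem_below => am.
have [Na|aN] := leqP N (mdeg a); first by rewrite hN // mul0r.
rewrite [X in _ * X]hM ?mulr0 //; rewrite -(leq_add2l (mdeg a)) -mdegD addmC submK //.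
by apply: leq_trans h; rewrite leq_add2r ltnW.
Qed.

Record rees := Rees { rees_val :> mseries 1 A; _ : rees_val \in rees_pred }.
HB.instance Definition _ := [isSub for rees_val].
HB.instance Definition _ := [Choice of rees by <:].
HB.instance Definition _ :=
  GRing.SubChoice_isSubComPzRing.Build (mseries 1 A) rees_pred rees rees_subring.

Definition rees_map (c : k) : rees := Rees (rees_const (calg_map A c)).

Fact rees_map_zmod : zmod_morphism rees_map.
Proof. by move=> x y; apply: val_inj; rewrite /= !raddfB. Qed.
HB.instance Definition _ := GRing.isZmodMorphism.Build k rees rees_map rees_map_zmod.

Fact rees_map_monoid : monoid_morphism rees_map.
Proof.
by split=> [|x y]; apply: val_inj; rewrite /= ?rmorph1 ?rmorphM.
Qed.
HB.instance Definition _ := GRing.isMonoidMorphism.Build k rees rees_map rees_map_monoid.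

Fact gr0 m : ideal_pow max_ideal (mdeg m).+1 ((0 : rees) m).
Proof. by rewrite ms0E; exact: ideal0. Qed.
Fact grD (p q : rees) :
  (forall m, ideal_pow max_ideal (mdeg m).+1 (p m)) ->
  (forall m, ideal_pow max_ideal (mdeg m).+1 (q m)) ->
  forall m, ideal_pow max_ideal (mdeg m).+1 ((p + q) m).
Proof. by move=> hp hq m; rewrite msDE; exact: idealD. Qed.
Fact grM (p q : rees) :
  (forall m, ideal_pow max_ideal (mdeg m).+1 (q m)) ->
  forall m, ideal_pow max_ideal (mdeg m).+1 ((p * q) m).
Proof.
move=> hq m; rewrite msME; apply: ideal_sum => a; rewrite mem_below => am.
rewrite -{1}(submK am) addmC mdegD -addnS; apply: ideal_powD => //.
by case: p => p /= /asboolP[].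
Qed.

Definition gr_ideal : ideal rees :=
  @Ideal rees (fun p => forall m, ideal_pow max_ideal (mdeg m).+1 (p m)) gr0 grD grM.

Definition gr : calg k :=
  @CAlg k (quotr gr_ideal) (@quotr_pi _ gr_ideal \o rees_map : {rmorphism _ -> _}).

End AssociatedGraded.

(* The divided power ring P with its basis 'x^[a]', a : 'X_{1..n}; only its structure
   of S-module is used, so the divided power product is omitted. *)
Definition dppoly n (k : fieldType) := {freeg 'X_{1..n} / k}.

Section Apolar.
Context (n : nat) (k : fieldType).
Local Notation S := (mseries n k).
Local Notation P := (dppoly n k).
Implicit Types (s t : S) (f g : P).

(* On the basis, s _| x^[b] is the sum of the s_a x^[b-a] for a <= b. *)
Definition contract_basis s (b : 'X_{1..n}) : P :=
  \sum_(a <- mnm_below b) << s a *g (b - a)%MM >>.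

Definition contract s f : P := fglift (contract_basis s) f.

Lemma contractB s : zmod_morphism (contract s).
Proof. exact: lift_is_additive. Qed.
HB.instance Definition _ s := GRing.isZmodMorphism.Build P P (contract s) (contractB s).

Lemma contractU s c b : contract s << c *g b >> = c *: contract_basis s b.
Proof. exact: liftU. Qed.

Lemma contract_freeg s f :
  contract s f = \sum_(b <- dom f) coeff b f *: contract_basis s b.
Proof.
rewrite -{1}[f]freeg_sumE raddf_sum; apply: eq_bigr => b _; exact: contractU.
Qed.

Lemma freegUZ c d (b : 'X_{1..n}) : << c * d *g b >> = c *: << d *g b >> :> P.
Proof.
by apply/eqP/freeg_eqP => x; rewrite coeffZ !coeffU mulrA.
Qed.

Lemma contractDl s t f : contract (s + t) f = contract s f + contract t f.
Proof.
rewrite !contract_freeg -big_split; apply: eq_bigr => b _ /=.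
rewrite -scalerDr /contract_basis -big_split; congr (_ *: _).
apply: eq_bigr => a _ /=; apply/eqP/freeg_eqP => x.
by rewrite coeffD !coeffU mulrDl.
Qed.

Lemma contract0l f : contract 0 f = 0.
Proof. by apply: (addrI (contract 0 f)); rewrite -contractDl !addr0. Qed.

Lemma contractZ s c f : contract s (c *: f) = c *: contract s f.
Proof.
rewrite -{1}[f]freeg_sumE scaler_sumr raddf_sum contract_freeg scaler_sumr.
by apply: eq_bigr => b _ /=; rewrite -freegUZ contractU scalerA.
Qed.

Lemma contract_mul s t f : contract (s * t) f = contract s (contract t f).
Proof.
rewrite (contract_freeg t) raddf_sum (contract_freeg (s * t)).
apply: eq_bigr => b _ /=; rewrite contractZ; congr (_ *: _).
rewrite {2}/contract_basis raddf_sum mulrC /contract_basis.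
under [RHS]eq_bigr => a _ do rewrite /= contractU /contract_basis scaler_sumr.
under [RHS]eq_bigr => a _ do under eq_bigr => c _ do rewrite -freegUZ.
rewrite -(sum_below_assoc (fun a c d => << t a * s c *g d >> : P)).
apply: eq_bigr => a _; apply/eqP/freeg_eqP => x.
rewrite msME coeffU raddf_sum mulr_suml; apply/eqP; rewrite eq_sym; apply/eqP.
by apply: eq_bigr => c _; rewrite /= coeffU.
Qed.

Fact annD f s t : contract s f = 0 -> contract t f = 0 -> contract (s + t) f = 0.
Proof. by move=> hs ht; rewrite contractDl hs ht addr0. Qed.
Fact annM f s t : contract t f = 0 -> contract (s * t) f = 0.
Proof. by move=> ht; rewrite contract_mul ht raddf0. Qed.

Definition ann f : ideal S :=
  @Ideal S (fun s => contract s f = 0) (contract0l f) (@annD f) (@annM f).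

Definition apolar f : calg k :=
  @CAlg k (quotr (ann f)) (@quotr_pi _ (ann f) \o @ms_const n k : {rmorphism _ -> _}).

Definition canonically_graded f : Prop := calg_isom (apolar f) (gr (apolar f)).

Definition dp_le (d : nat) f : Prop := {in dom f, forall b, (mdeg b <= d)%N}.

(* The coordinates of f on the basis of P_(<= d). *)
Definition dp_coord (d : nat) f : 'I_#|{: 'X_{1..n < d.+1}}| -> k :=
  fun i => coeff (bmnm (enum_val i)) f.
Arguments dp_coord d f : clear implicits.

(* U is the complement in P_(<= d) of the common zeros of a set E of polynomials in
   the coordinates. *)
Definition zariski_open (d : nat) (U : P -> Prop) : Prop :=
  exists E : {mpoly k[#|{: 'X_{1..n < d.+1}}|]} -> Prop,
    forall f, U f <-> dp_le d f /\ exists2 p, E p & p.@[dp_coord d f] != 0.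

End Apolar.

(* Main.v *)
(** Let [f = f_d + f_(d-1) + ...] with [f_d <> 0] and let [phi : Apolar f -> gr Apolar f]
   be an isomorphism.  The degree-one parts [z_i] of [phi alpha_i] satisfy only
   homogeneous relations, and their preimages are the classes of series
   [H_i = alpha_i + O(2)].  Suppose that a form [p] of degree [d-1] satisfies
   [<(dp/dalpha_i) q, f_d> = 0] for all [i] and all quadrics [q].  By Euler's formula [p]
   annihilates [f_d], and by Taylor expansion [p(H)] sends [f] to the constant [<p, f>].
   That constant is also the contraction of [f] by a multiple of a monomial of degree [d]
   in [H]; so [p(H)] minus this multiple is a relation, and homogeneity forces
   [<p, f> = 0].  Outside the list,
   [n * 'C(n + 1, 2) < 'C(n + d - 2, d - 1)], so a nonzero such [p] exists for every
   [f_d]; moving [f_(d-1)] along a line inside [U] then makes [<p, f>] nonzero. *)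
Require Import Defs.
From HB Require Import structures.
From mathcomp Require Import all_boot all_order all_algebra.
From mathcomp Require Import boolp freeg mpoly.
From mathcomp Require Import ring zify.
Set Implicit Arguments.
Unset Strict Implicit.
Unset Printing Implicit Defensive.
Import GRing.Theory.
Local Open Scope ring_scope.

(** * Power series, monomials and the contraction pairing *)

Section Series.
Context (n : nat) (R : comPzRingType).
Implicit Types (s t : mseries n R) (a b m : 'X_{1..n}).

Definition msX a : mseries n R := MSeries (fun m => (m == a)%:R).

Lemma msXME a s m :
  (msX a * s) m = if (a <= m)%MM then s (m - a)%MM else 0.
Proof.
rewrite msME; have [am|am] := boolP (a <= m)%MM.
  rewrite (bigD1_seq a) ?uniq_below ?mem_below //= eqxx mul1r.
  by rewrite big1 ?addr0 // => b /negbTE ->; rewrite mul0r.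
rewrite big_seq big1 // => b; rewrite mem_below /= => bm.
by case: eqP bm am => [->->|_ _ _] //; rewrite mul0r.
Qed.

Lemma msX0 : msX 0 = 1.
Proof. by apply/mseriesP => m; rewrite ms1E /=; case: eqP. Qed.

Lemma msXD a b : msX (a + b) = msX a * msX b.
Proof.
apply/mseriesP => m; rewrite msXME /=; have [am|] := boolP (a <= m)%MM.
  by rewrite -[in LHS](submK am) (addmC a) eqm_add2r.
by case: eqP => // ->; rewrite lem_addr.
Qed.

Fact ms_ord0 e m : (mdeg m < e)%N -> (0 : mseries n R) m = 0.
Proof. by rewrite ms0E. Qed.
Fact ms_ordD e s t : (forall m, (mdeg m < e)%N -> s m = 0) ->
  (forall m, (mdeg m < e)%N -> t m = 0) ->
  forall m, (mdeg m < e)%N -> (s + t) m = 0.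
Proof. by move=> hs ht m me; rewrite msDE hs ?ht ?addr0. Qed.
Fact ms_ordM e s t : (forall m, (mdeg m < e)%N -> t m = 0) ->
  forall m, (mdeg m < e)%N -> (s * t) m = 0.
Proof.
move=> ht m me; rewrite msME big_seq big1 // => a _.
by rewrite ht ?mulr0 // (leq_ltn_trans (mdegB _ _)).
Qed.

(** Over a field this is the [e]-th power of the maximal ideal of the power series ring. *)
Definition ms_ord e : ideal (mseries n R) :=
  Ideal (@ms_ord0 e) (@ms_ordD e) (@ms_ordM e).

Lemma ms_ord_le e e' s : (e <= e')%N -> ms_ord e' s -> ms_ord e s.
Proof. by move=> ee hs m /leq_trans me; apply/hs/me. Qed.

Lemma ms_ord_mul e e' s t : ms_ord e s -> ms_ord e' t -> ms_ord (e + e') (s * t).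
Proof.
move=> hs ht m me; rewrite msME big_seq big1 // => a; rewrite mem_below => am.
have [ae|ea] := ltnP (mdeg a) e; first by rewrite hs ?mul0r.
rewrite ht ?mulr0 // -(ltn_add2l (mdeg a)) -mdegD addmC submK //.
by apply: leq_trans me _; rewrite leq_add2r.
Qed.

Lemma ms_ord_exp e s i : ms_ord e s -> ms_ord (e * i) (s ^+ i).
Proof.
move=> hs; elim: i => [|i IH]; first by rewrite muln0.
by rewrite exprS mulnS; apply: ms_ord_mul.
Qed.

Lemma ms_ordX a : ms_ord (mdeg a) (msX a).
Proof. by move=> m /=; case: eqP => // ->; rewrite ltnn. Qed.

Lemma ms_ord1P s : ms_ord 1 s <-> s 0%MM = 0.
Proof.
split=> [->//|s0 m]; first by rewrite mdeg0.
by rewrite ltnS leqn0 mdeg_eq0 => /eqP ->.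
Qed.

Lemma ms_coef0M s t : (s * t) 0%MM = s 0%MM * t 0%MM.
Proof.
rewrite msME (bigD1_seq 0%MM) ?uniq_below ?mem_below ?lepm_refl //=.
rewrite subm0 big_seq_cond big1 ?addr0 // => a /andP[]; rewrite mem_below => h.
by rewrite -mdeg_eq0 -leqn0 -[X in (_ <= X)%N](@mdeg0 n) lem_mdeg.
Qed.

Lemma ms_coef0X s i : (s ^+ i) 0%MM = s 0%MM ^+ i.
Proof.
by elim: i => [|i IH]; rewrite ?expr0 ?ms1E ?eqxx // !exprS ms_coef0M IH.
Qed.

End Series.

(** * First-order Taylor expansion of monomials *)

Section Monomials.
Context (n : nat).
Implicit Types (a b m : 'X_{1..n}).

Definition mnmexp (R : comPzRingType) (h : 'I_n -> R) b := \prod_i h i ^+ b i.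

Lemma mnmexp0 (R : comPzRingType) (h : 'I_n -> R) : mnmexp h 0%MM = 1.
Proof. by rewrite /mnmexp big1 // => i _; rewrite mnm0E. Qed.

Lemma mnmexpDU (R : comPzRingType) (h : 'I_n -> R) b j :
  mnmexp h (U_(j) + b)%MM = h j * mnmexp h b.
Proof.
rewrite /mnmexp (bigD1 j) //= [in RHS](bigD1 j) //= mnmDE mnm1E eqxx exprS.
rewrite -mulrA; congr (_ * (_ * _)); apply: eq_bigr => i ij.
by rewrite mnmDE mnm1E eq_sym (negbTE ij).
Qed.

Lemma rmorph_mnmexp (R T : comPzRingType) (phi : {rmorphism R -> T}) h b :
  phi (mnmexp h b) = mnmexp (phi \o h) b.
Proof. by rewrite rmorph_prod; apply: eq_bigr => i _; rewrite rmorphXn. Qed.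

Lemma mnm_addU_ind (P : 'X_{1..n} -> Prop) :
  P 0%MM -> (forall i b, P b -> P (U_(i) + b)%MM) -> forall b, P b.
Proof.
move=> P0 PS b; have [e] := ubnP (mdeg b); elim: e b => // e IH b be.
have [b0|/negbTE] := boolP [forall i, b i == 0%N].
  suff -> : b = 0%MM by [].
  by apply/mnmP => i; rewrite mnm0E; exact/eqP/(forallP b0).
move/negbT; rewrite negb_forall => /existsP[i bi].
have ib : (U_(i) <= b)%MM by rewrite lep1mP.
rewrite -(submK ib) addmC; apply/PS/IH; move: be.
by rewrite -{1}(submK ib) mdegD mdeg1 addn1 ltnS.
Qed.

Context (R : comPzRingType).
Local Notation X := (@msX n R).

(* [\sum_i Q_i d(X^b)/dX_i] *)
Definition taylor1 (Q : 'I_n -> mseries n R) b : mseries n R :=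
  \sum_i Q i * (X (b - U_(i)) *+ b i).

Lemma msX_derivDU b i j :
  X (U_(j) + b - U_(i))%MM *+ (U_(j) + b)%MM i =
  X U_(j) * (X (b - U_(i))%MM *+ b i) + X b *+ (j == i).
Proof.
rewrite mnmDE mnm1E mulrnDr addrC mulrnAr -msXD; congr (_ + _); last first.
  by case: eqP => // ->; rewrite addmC addmK.
by have [->//|bi] := eqVneq (b i) 0%N; rewrite addmBA // lep1mP.
Qed.

Lemma taylor1_ord Q b : (forall i, ms_ord n R 2 (Q i)) ->
  ms_ord n R (mdeg b + 1) (taylor1 Q b).
Proof.
move=> hQ; apply: ideal_sum => i _; have [->|bi] := eqVneq (b i) 0%N.
  by rewrite mulr0n mulr0; exact: ideal0.
have ib : (U_(i) <= b)%MM by rewrite lep1mP.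
rewrite mulrnAr -mulrnAl; have -> : (mdeg b + 1 = 2 + mdeg (b - U_(i)))%N.
  by rewrite -{1}(submK ib) mdegD mdeg1 !addn1 add2n.
by apply: ms_ord_mul (@ms_ordX _ _ _); rewrite -mulr_natl; exact: idealM.
Qed.

(** Terms of second order in [Q] have order at least [(mdeg b - 2) + 4]. The induction adds one
    variable: by the product rule for [taylor1], the new remainder is
    [(X_j + Q_j) * E + Q_j * T]. *)
Lemma mnmexp_taylor1 Q b : (forall i, ms_ord n R 2 (Q i)) ->
  ms_ord n R (mdeg b + 2)
    (mnmexp (fun i => X U_(i) + Q i) b - X b - taylor1 Q b).
Proof.
move=> hQ; elim/mnm_addU_ind: b.
  rewrite mnmexp0 msX0 subrr sub0r; apply: idealN; rewrite /taylor1.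
  by apply: ideal_sum => i _; rewrite mnm0E mulr0n mulr0; exact: ideal0.
move=> j b IH; rewrite mnmexpDU; set H := mnmexp _ b in IH *.
set T := taylor1 Q b in IH *; set E := H - X b - T in IH.
have hT : ms_ord n R (mdeg b + 1) T by exact: taylor1_ord.
have -> : taylor1 Q (U_(j) + b) = X U_(j) * T + Q j * X b.
  rewrite /taylor1; under eq_bigr do rewrite msX_derivDU mulrDr mulrCA.
  rewrite big_split -mulr_sumr /=; congr (_ + _).
  rewrite (bigD1 j) //= eqxx mulr1n big1 ?addr0 // => i; rewrite eq_sym => /negbTE ->.
  by rewrite mulr0n mulr0.
have -> : (X U_(j) + Q j) * H - X (U_(j) + b) - (X U_(j) * T + Q j * X b) =
          (X U_(j) + Q j) * E + Q j * T.
  by rewrite msXD /E; ring.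
rewrite mdegD mdeg1 -addnA; apply: idealD.
  apply: ms_ord_mul IH; apply: idealD; last exact: ms_ord_le (hQ j).
  by rewrite -(mdeg1 j); exact: ms_ordX.
apply: ms_ord_le (ms_ord_mul (hQ j) hT).
by rewrite addnCA [X in (_ <= X)%N]addnCA.
Qed.
End Monomials.

(** * The duality between series and divided power polynomials *)

Section Pairing.
Context (n : nat) (k : fieldType).
Implicit Types (f : dppoly n k) (s t : mseries n k) (a b m : 'X_{1..n}).

(** This is the constant coefficient of [contract s f]. *)
Definition pair f s : k := \sum_(b <- dom f) coeff b f * s b.

Fact pair_zmod f : zmod_morphism (pair f).
Proof.
move=> s t; rewrite /pair -sumrB; apply: eq_bigr => b _.
by rewrite msBE mulrBr.
Qed.
HB.instance Definition _ f :=
  GRing.isZmodMorphism.Build (mseries n k) k (pair f) (pair_zmod f).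

Lemma pairZ f c s : pair f (ms_const n c * s) = c * pair f s.
Proof.
rewrite /pair mulr_sumr; apply: eq_bigr => b _.
by rewrite [X in _ * X]ms_const_mulE mulrCA.
Qed.

Lemma pairX f a : pair f (msX k a) = coeff a f.
Proof.
have [ad|ad] := boolP (a \in dom f).
  rewrite /pair (bigD1_seq a) ?uniq_dom //= eqxx mulr1.
  by rewrite big1 ?addr0 // => b /negbTE ->; rewrite mulr0.
rewrite coeff_outdom // /pair big_seq big1 // => b bd /=.
by case: eqP bd ad => [->->|_ _ _] //; rewrite mulr0.
Qed.

(** Contraction is adjoint to multiplication, which turns annihilation of [f] into scalar
    conditions. *)
Lemma coeff_contract f s a : coeff a (contract s f) = pair f (msX k a * s).
Proof.
rewrite contract_freeg raddf_sum; apply: eq_bigr => b _.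
rewrite [LHS]coeffZ; congr (_ * _); rewrite msXME raddf_sum /=.
under eq_bigr do rewrite coeffU.
have [ab|ab] := boolP (a <= b)%MM; last first.
  rewrite big_seq big1 // => c _.
  by case: eqP ab => [<-|_ _]; rewrite ?lem_subr ?mulr0.
rewrite (bigD1_seq (b - a)%MM) ?uniq_below ?mem_below ?lem_subr //=.
rewrite subKm // eqxx mulr1 big_seq_cond big1 ?addr0 // => c.
rewrite mem_below => /andP[cb ne]; case: eqP => [e|_]; last by rewrite mulr0.
by rewrite -e subKm ?eqxx in ne.
Qed.

Lemma contract_eq0P f s :
  contract s f = 0 <-> forall a, pair f (msX k a * s) = 0.
Proof.
split=> [s0 a|s0]; first by rewrite -coeff_contract s0 coeff0.
by apply/eqP/freeg_eqP => a; rewrite coeff_contract s0 coeff0.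
Qed.

Lemma pair_ord d f s : dp_le d f -> ms_ord n k d.+1 s -> pair f s = 0.
Proof.
move=> fd sd; rewrite /pair big_seq big1 // => b /fd bd.
by rewrite [X in _ * X]sd ?mulr0.
Qed.

End Pairing.

(** * The local ring of an apolar algebra *)

Section IdealImage.
Context (R : comPzRingType) (I J : ideal R).

Fact ideal_img0 : exists2 s, J s & (0 : quotr I) = quotr_pi I s.
Proof. by exists 0; [exact: ideal0 | rewrite raddf0]. Qed.
Fact ideal_imgD (x y : quotr I) :
  (exists2 s, J s & x = quotr_pi I s) -> (exists2 s, J s & y = quotr_pi I s) ->
  exists2 s, J s & x + y = quotr_pi I s.
Proof.
move=> [s hs ->] [t ht ->]; exists (s + t); first exact: idealD.
by rewrite raddfD.
Qed.
Fact ideal_imgM (a x : quotr I) :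
  (exists2 s, J s & x = quotr_pi I s) -> exists2 s, J s & a * x = quotr_pi I s.
Proof.
move=> [s hs ->]; exists (repr a * s); first exact: idealM.
by rewrite rmorphM /= quotr_repr.
Qed.

Definition ideal_img : ideal (quotr I) := Ideal ideal_img0 ideal_imgD ideal_imgM.

End IdealImage.

Section IdealPow.
Context (R : comPzRingType) (I : ideal R).

Lemma ideal_pow_leq i j x : (i <= j)%N -> ideal_pow I j x -> ideal_pow I i x.
Proof.
move=> /subnK <-; elim: (j - i)%N x => // l IH x.
by rewrite addSn => /ideal_pow_le; exact: IH.
Qed.

Lemma ideal_pow1 x : ideal_pow I 1 x <-> I x.
Proof.
split; first by apply: ideal_gen_sub => z [a [b [Ia _ ->]]]; rewrite mulrC; exact: idealM.
by move=> Ix; apply: ideal_gen_mem; exists x, 1; rewrite mulr1.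
Qed.

Lemma ideal_pow_exp x i : I x -> ideal_pow I i (x ^+ i).
Proof.
move=> Ix; elim: i => // i IH; rewrite exprS -add1n; apply: ideal_powD IH.
exact/ideal_pow1.
Qed.

End IdealPow.

(** With [u = 1 - s / s(0)], of order one, the truncated geometric series leaves the error [u ^+ e].
    Truncation suffices because series of order [d.+1] annihilate polynomials of degree at most
    [d]. *)
Lemma ms_unit_mod n (k : fieldType) e (s : mseries n k) : s 0%MM != 0 ->
  exists t, ms_ord n k e (1 - s * t).
Proof.
move=> s0; pose u := 1 - ms_const n (s 0%MM)^-1 * s.
exists (ms_const n (s 0%MM)^-1 * \sum_(i < e) u ^+ i).
have -> : 1 - s * (ms_const n (s 0%MM)^-1 * \sum_(i < e) u ^+ i) = u ^+ e.
  have -> : u ^+ e = 1 + (u - 1) * \sum_(i < e) u ^+ i by rewrite -subrX1 subrKC.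
  by rewrite /u; ring.
rewrite -[e in ms_ord _ _ e]mul1n; apply/ms_ord_exp/ms_ord1P.
rewrite /u msBE ms1E eqxx ms_coef0M /= eqxx mulVf ?subrr //.
Qed.

Section ApolarLocal.
Context (n : nat) (k : fieldType) (d : nat) (f : dppoly n k).
Hypotheses (fd : dp_le d f) (f0 : f != 0).
Implicit Types (s t : mseries n k) (x : apolar f).
Local Notation pi := (quotr_pi (ann f)).
Local Notation mA := (max_ideal (apolar f)).

Lemma ann_ord s : ms_ord n k d.+1 s -> ann f s.
Proof.
move=> sd; apply/contract_eq0P => a; apply: pair_ord fd _; exact: idealM.
Qed.

Lemma quotr_pi0P s : pi s = 0 <-> ann f s.
Proof. by have := quotr_eqP (ann f) s 0; rewrite raddf0 subr0. Qed.

Lemma apolar_unit s : s 0%MM != 0 -> exists y : apolar f, pi s * y = 1.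
Proof.
move=> /(ms_unit_mod d.+1)[t] /ann_ord ht; exists (pi t).
apply/eqP; rewrite -rmorphM -(rmorph1 pi); apply/eqP/quotr_eqP.
by rewrite -opprB; exact: idealN.
Qed.

(** Otherwise [s] would be a unit modulo order [d.+1], so [1] would annihilate [f]. *)
Lemma ann_coef0 s : ann f s -> s 0%MM = 0.
Proof.
move=> sf; apply/eqP/negP => /negP /(ms_unit_mod d.+1)[t] /ann_ord ht.
have h1 : ann f 1.
  by rewrite -(subrK (s * t) 1); apply: idealD => //; rewrite mulrC; exact: idealM.
case/negP: f0; apply/eqP/eqP/freeg_eqP => a.
by rewrite coeff0 -pairX -[msX k a]mulr1; move/contract_eq0P: h1 => ->.
Qed.

(** A class with nonzero constant term is a unit; one with zero constant term is not, since members
    of [ann f] have no constant term. *)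
Lemma max_apolarP x : mA x <-> exists2 s, ms_ord n k 1 s & x = pi s.
Proof.
split.
  apply: (ideal_gen_sub (I := ideal_img (ann f) (ms_ord n k 1))) => y hy.
  exists (repr y); last by rewrite quotr_repr.
  apply/ms_ord1P/eqP/negP => /negP /apolar_unit; rewrite quotr_repr.
  exact: hy.
move=> [s /ms_ord1P s0 ->]; apply: ideal_gen_mem => -[y].
rewrite -[y]quotr_repr -rmorphM -(rmorph1 pi) => /quotr_eqP /ann_coef0.
rewrite msBE ms_coef0M s0 mul0r ms1E eqxx sub0r => /eqP.
by rewrite oppr_eq0 oner_eq0.
Qed.

Lemma max_apolar_pow e x :
  ideal_pow mA e x -> exists2 s, ms_ord n k e s & x = pi s.
Proof.
elim: e x => [|e IH] x; first by move=> _; exists (repr x); rewrite ?quotr_repr.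
apply: (ideal_gen_sub (I := ideal_img (ann f) (ms_ord n k e.+1))).
move=> _ [a [b [/max_apolarP[s hs ->] /IH[t ht ->] ->]]].
by exists (s * t); rewrite ?rmorphM // -add1n; apply: ms_ord_mul.
Qed.

Lemma max_apolar_nilp x : ideal_pow mA d.+1 x -> x = 0.
Proof. by move=> /max_apolar_pow[s /ann_ord hs ->]; exact/quotr_pi0P. Qed.

(** Constant coefficients lie in a field, which is reduced. This is what places nilpotent elements
    in [mA]. *)
Lemma max_apolar_root x i : mA (x ^+ i) -> mA x.
Proof.
move=> /max_apolarP[s /ms_ord1P s0 e]; apply/max_apolarP.
exists (repr x); last by rewrite quotr_repr.
move: e; rewrite -{1}[x]quotr_repr -rmorphXn => /quotr_eqP /ann_coef0.
rewrite msBE s0 subr0 ms_coef0X => /eqP; rewrite expf_eq0 => /andP[_ /eqP h].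
exact/ms_ord1P.
Qed.

End ApolarLocal.

(** * Homogeneous elements of the Rees algebra *)

Section GradedMonomials.
Context (k : comPzRingType) (A : calg k).
Implicit Types (y z : A).
Local Notation mA := (max_ideal A).

Lemma mnm_mdeg1 (m : 'X_{1..1}) j :
  (m == (U_(ord0) *+ j)%MM) = (mdeg m == j).
Proof.
apply/eqP/eqP => [->|<-]; first by rewrite mdegMn mdeg1 mul1n.
apply/mnmP => i; rewrite mulmnE mnm1E [i]ord1 eqxx mul1n.
by rewrite mdegE big_ord1.
Qed.

(* [y T^j] *)
Definition gmono j y : mseries 1 A := ms_const 1 y * msX A (U_(ord0) *+ j)%MM.

Lemma gmonoE j y m : gmono j y m = if mdeg m == j then y else 0.
Proof.
rewrite [LHS]ms_const_mulE /= mnm_mdeg1.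
by case: eqP; rewrite ?mulr1 ?mulr0.
Qed.

Lemma gmonoM i j y z : gmono i y * gmono j z = gmono (i + j) (y * z).
Proof.
rewrite /gmono; have -> : (U_(ord0) *+ (i + j) = U_(ord0) *+ i + U_(ord0) *+ j :> 'X_{1..1})%MM.
  by apply/mnmP => l; rewrite mnmDE !mulmnE mulnDr.
by rewrite msXD rmorphM; ring.
Qed.

Lemma gmono0 y : gmono 0 y = ms_const 1 y.
Proof. by rewrite /gmono mulm0n msX0 mulr1. Qed.

Lemma gmonoX j y i : gmono j y ^+ i = gmono (j * i) (y ^+ i).
Proof.
elim: i => [|i IH]; first by rewrite muln0 gmono0 rmorph1.
by rewrite !exprS IH gmonoM mulnS.
Qed.

Lemma gmono_mnmexp n (y : 'I_n -> A) b :
  mnmexp (fun i => gmono 1 (y i)) b = gmono (mdeg b) (mnmexp y b).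
Proof.
elim/mnm_addU_ind: b => [|i b IH].
  by rewrite mdeg0 !mnmexp0 gmono0 rmorph1.
by rewrite !mnmexpDU IH gmonoM mdegD mdeg1.
Qed.

Lemma gmono_rees j y : ideal_pow mA j y -> gmono j y \in @rees_pred k A.
Proof.
move=> hy; apply/asboolP; split=> [m|].
  by rewrite gmonoE; case: eqP => [->//|_]; exact: ideal0.
by exists j.+1 => m; rewrite gmonoE; case: eqP => // ->; rewrite ltnn.
Qed.

Lemma rees_pow (w : rees A) m : ideal_pow mA (mdeg m) (w m).
Proof. by case: w => w /= /asboolP[]. Qed.

Lemma rees_valX (w : rees A) i : rees_val (w ^+ i) = rees_val w ^+ i.
Proof. exact: (rmorphXn (\val : rees A -> mseries 1 A)). Qed.

(** Since each [w i] is homogeneous of degree one, the power of [T] records the degree of each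
    monomial in [w]. *)
Lemma rees_sumE n (w : 'I_n -> rees A) (y : 'I_n -> A)
    (r : seq 'X_{1..n}) (P : pred 'X_{1..n}) (c : 'X_{1..n} -> k) m :
  (forall i, rees_val (w i) = gmono 1 (y i)) ->
  (\sum_(a <- r | P a) rees_map A (c a) * mnmexp w a : rees A) m =
  \sum_(a <- r | P a && (mdeg m == mdeg a)) calg_map A (c a) * mnmexp y a.
Proof.
move=> hw; rewrite big_mkcondr /=; elim/big_rec2: _ => [|a x z _ <-]; first exact: ms0E.
transitivity ((rees_map A (c a) * mnmexp w a) m + z m) => //; congr (_ + _).
have -> : rees_val (rees_map A (c a) * mnmexp w a) =
    ms_const 1 (calg_map A (c a)) * gmono (mdeg a) (mnmexp y a).
  transitivity (rees_val (rees_map A (c a)) * rees_val (mnmexp w a)) => //.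
  rewrite -gmono_mnmexp [rees_val (mnmexp w a)](rmorph_mnmexp (\val : rees A -> mseries 1 A)).
  congr (_ * _); apply: eq_bigr => i _; congr (_ ^+ _); exact: hw.
by rewrite -gmono0 gmonoM add0n gmonoE.
Qed.

End GradedMonomials.

(** * Homogeneous relations from canonical gradedness *)

Section CanonicallyGraded.
Context (n : nat) (k : fieldType) (d : nat) (f : dppoly n k).
Hypotheses (fd : dp_le d f) (f0 : f != 0).
Local Notation A := (apolar f).
Local Notation mA := (max_ideal A).
Local Notation pi := (quotr_pi (ann f)).
Local Notation pg := (quotr_pi (gr_ideal A)).
Variables (phi : {rmorphism A -> gr A}) (psi : gr A -> A).
Hypotheses (phiK : cancel phi psi) (psiK : cancel psi phi).
Hypothesis phi_map : forall c, phi (calg_map A c) = calg_map (gr A) c.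

(** [phi] need not respect the grading, so this set collects the [y] for which the class of [y T^j]
    comes from the square of [mA]. The element [w] is carried along because [y T^j] lies in the Rees
    algebra only for [y] in the [j]-th power. *)
Definition sq_preim_set j (y : A) : Prop := exists w x,
  [/\ rees_val w = gmono j y, ideal_pow mA 2 x & phi x = pg w].

Fact sq_preim0 j : sq_preim_set j 0.
Proof.
exists 0, 0; rewrite !raddf0; split=> //; last exact: ideal0.
by rewrite /gmono raddf0 mul0r.
Qed.

Fact sq_preimD j y z :
  sq_preim_set j y ->
  sq_preim_set j z ->
  sq_preim_set j (y + z).
Proof.
move=> [w [x [wj x2 e]]] [w' [x' [wj' x2' e']]]; exists (w + w'), (x + x').
split; [|exact: idealD|by rewrite rmorphD e e' -rmorphD].
by rewrite /= wj wj' /gmono raddfD mulrDl.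
Qed.

Fact sq_preimM j a y :
  sq_preim_set j y ->
  sq_preim_set j (a * y).
Proof.
move=> [w [x [wj x2 e]]]; pose ra := Rees (rees_const a).
exists (ra * w), (psi (pg ra) * x); split; last by rewrite !rmorphM psiK e.
  by rewrite -[RHS](gmonoM (A := A) 0 j) gmono0 -wj.
exact: idealM.
Qed.

Definition sq_preim j : ideal A := Ideal (sq_preim0 j) (@sq_preimD j) (@sq_preimM j).

(** [y T^j] is nilpotent because [y] is, so its preimage is nilpotent and lies in [mA]. *)
Lemma max_preim_gmono j y (w : rees A) : (0 < j)%N -> ideal_pow mA j y ->
  rees_val w = gmono j y -> mA (psi (pg w)).
Proof.
move=> j0 yj wj; apply: (max_apolar_root fd f0 (i := d.+1)).
have ym : mA y by apply/ideal_pow1; apply: ideal_pow_leq yj.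
suff w0 : w ^+ d.+1 = 0.
  suff -> : psi (pg w) ^+ d.+1 = 0 by exact: ideal0.
  by apply: (can_inj phiK); rewrite rmorphXn /= psiK -rmorphXn w0 !raddf0.
apply: val_inj; rewrite [LHS]rees_valX wj gmonoX.
by rewrite (max_apolar_nilp fd f0 (ideal_pow_exp _ ym)) /gmono raddf0 mul0r.
Qed.

(** On generators [y = a b], factor [a b T^j = (a T)(b T^(j-1))]; both factors have preimages in
    [mA]. *)
Lemma sq_preim_gmono j y : (1 < j)%N -> ideal_pow mA j y -> sq_preim j y.
Proof.
case: j => [//|[//|j]] _; apply: ideal_gen_sub => _ [a [b [am bj ->]]].
change (ideal_pow mA j.+1 b) in bj.
have am1 : ideal_pow mA 1 a by apply/ideal_pow1.
pose wa := Rees (gmono_rees am1); pose wb := Rees (gmono_rees bj).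
exists (wa * wb), (psi (pg wa) * psi (pg wb)).
split; [exact: gmonoM| | by rewrite !rmorphM !psiK].
have := max_preim_gmono (w := wb) (ltn0Sn j) bj erefl.
have := max_preim_gmono (w := wa) (ltn0Sn 0) am1 erefl.
by move=> /ideal_pow1 ha /ideal_pow1; exact: ideal_powD ha.
Qed.

Lemma psiD x y : psi (x + y) = psi x + psi y.
Proof. by apply: (can_inj phiK); rewrite rmorphD !psiK. Qed.

(** The class of [w] has no components of degree 0 and 1. The others are removed degree by degree,
    each having a preimage in the square of [mA]; the process stops after degree [d]. *)
Lemma gr_sq_preim (w : rees A) :
  (forall m, (mdeg m < 2)%N -> ideal_pow mA (mdeg m).+1 (w m)) ->
  ideal_pow mA 2 (psi (pg w)).
Proof.
suff H j : (1 < j)%N ->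
    (forall m, (mdeg m < j)%N -> ideal_pow mA (mdeg m).+1 (w m)) ->
    ideal_pow mA 2 (psi (pg w)).
  by move=> h; exact: (H 2%N isT h).
have [l jl] := ubnP (d.+1 - j)%N; elim: l => // l IH in j w jl * => j1 wj.
have [dj|jd] := ltnP d j.
  (* Components below [j] vanish in [gr A]; the remaining ones lie in the power [d.+1] of [mA],
     which is zero. *)
  suff -> : pg w = 0.
    suff -> : psi 0 = 0 by exact: ideal0.
    by apply: (can_inj phiK); rewrite psiK raddf0.
  have := quotr_eqP (gr_ideal A) w 0; rewrite raddf0 subr0 => -[_]; apply => m.
  have [/wj//|jm] := ltnP (mdeg m) j.
  suff -> : w m = 0 by exact: ideal0.
  apply: (max_apolar_nilp fd f0).
  exact: ideal_pow_leq (leq_trans dj jm) (rees_pow w m).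
pose m0 : 'X_{1..1} := (U_(ord0) *+ j)%MM.
have em0 : mdeg m0 = j by rewrite mdegMn mdeg1 mul1n.
have := rees_pow w m0; rewrite em0 => wm0.
have [v [x [vj x2 ex]]] := sq_preim_gmono j1 wm0.
(* Trade the component of degree [j] for its preimage [x]. *)
have -> : pg w = pg (w - v) + phi x by rewrite ex -rmorphD subrK.
rewrite psiD phiK; apply: idealD x2.
apply: (IH j.+1) => [|| m]; [|exact: leqW|].
  by rewrite -ltnS; apply: leq_trans jl; rewrite ltnS subnS ltn_predL subn_gt0 ltnS.
have -> : (w - v) m = w m - v m by [].
rewrite vj gmonoE ltnS leq_eqVlt => /orP[/eqP mj|mj].
  rewrite mj eqxx; have /eqP -> : m == m0 by rewrite mnm_mdeg1 mj.
  by rewrite subrr; exact: ideal0.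
by rewrite ltn_eqF // subr0; exact: wj.
Qed.

(** Take for [y] the degree-one component of a representative of [phi x]; then the difference has a
    class without components of degree 0 and 1. *)
Lemma gr_degree1 x : mA x -> exists y : A,
  ideal_pow mA 1 y /\
  forall w : rees A, rees_val w = gmono 1 y -> ideal_pow mA 2 (x - psi (pg w)).
Proof.
move=> xm; set v : rees A := repr (phi x).
have ev : pg v = phi x by rewrite quotr_repr.
pose m1 : 'X_{1..1} := (U_(ord0) *+ 1)%MM; exists (v m1).
have v1 : ideal_pow mA 1 (v m1) by have := rees_pow v m1; rewrite mdegMn mdeg1.
split=> // w wv.
have -> : x - psi (pg w) = psi (pg (v - w)).
  by apply: (can_inj phiK); rewrite rmorphB !psiK -ev -rmorphB.
apply: gr_sq_preim => m.
have -> : (v - w) m = v m - w m by [].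
rewrite wv gmonoE; case: eqP => [m1E _|].
  have /eqP -> : m == m1 by rewrite mnm_mdeg1 m1E.
  by rewrite subrr; exact: ideal0.
(* In degree zero, nilpotency of [phi x] puts a power of the constant component of [v] into [mA]. *)
case em: (mdeg m) => [|[|//]] // _ _; rewrite subr0.
have /eqP -> : m == 0%MM by rewrite -mdeg_eq0 em.
apply/ideal_pow1/(max_apolar_root fd f0 (i := d.+1)).
have /quotr_eqP/(_ 0%MM) : pg (v ^+ d.+1) = pg 0.
  rewrite rmorphXn /= ev -rmorphXn.
  by rewrite (max_apolar_nilp fd f0 (ideal_pow_exp d.+1 xm)) !raddf0.
have -> : (v ^+ d.+1 - 0) 0%MM = v 0%MM ^+ d.+1.
  by rewrite subr0 rees_valX ms_coef0X.
by rewrite mdeg0 => /ideal_pow1.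
Qed.

(** The preimage of the degree-one part of the image of [alpha_i] differs from [alpha_i] by an
    element of the square of [mA], which lifts to a series of order two. *)
Lemma graded_generators : exists H : 'I_n -> mseries n k,
  (forall i, ms_ord n k 2 (H i - msX k U_(i))) /\
  exists y : 'I_n -> A, forall i, exists2 w : rees A,
    rees_val w = gmono 1 (y i) & phi (pi (H i)) = pg w.
Proof.
have hX i : mA (pi (msX k U_(i))).
  apply/(max_apolarP fd f0); exists (msX k U_(i)) => //.
  by rewrite -(mdeg1 i); exact: ms_ordX.
have [y hy] := choice (fun i => gr_degree1 (hX i)).
have y1 i : ideal_pow mA 1 (y i) by have [] := hy i.
pose w i := Rees (gmono_rees (y1 i)).
have hE i : exists E, ms_ord n k 2 E /\ pi (msX k U_(i)) - psi (pg (w i)) = pi E.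
  have [_ /(_ (w i) erefl)] := hy i.
  by move=> /(max_apolar_pow fd f0)[E hE ->]; exists E.
have [E {}hE] := choice hE; exists (fun i => msX k U_(i) - E i); split=> [i|].
  by rewrite addrC addKr; apply: idealN; case: (hE i).
exists y => i; exists (w i) => //; case: (hE i) => _ e.
by rewrite rmorphB /= -[pi (E i)]e subKr psiK.
Qed.

(** The images of the [H i] are homogeneous of degree one, and membership in [gr_ideal] is tested
    degree by degree. Injectivity of [phi] brings each homogeneous piece back. *)
Lemma graded_relations : exists H : 'I_n -> mseries n k,
  (forall i, ms_ord n k 2 (H i - msX k U_(i))) /\
  forall (r : seq 'X_{1..n}) (c : 'X_{1..n} -> k) e,
    ann f (\sum_(a <- r) ms_const n (c a) * mnmexp H a) ->
    ann f (\sum_(a <- r | mdeg a == e) ms_const n (c a) * mnmexp H a).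
Proof.
have [H [hH [y hy]]] := graded_generators; exists H; split=> // r c e.
have /choice[w hw] i : exists w : rees A,
    rees_val w = gmono 1 (y i) /\ phi (pi (H i)) = pg w.
  by have [v] := hy i; exists v.
have phiE (P : pred 'X_{1..n}) :
    phi (pi (\sum_(a <- r | P a) ms_const n (c a) * mnmexp H a)) =
    pg (\sum_(a <- r | P a) rees_map A (c a) * mnmexp w a).
  rewrite !rmorph_sum; apply: eq_bigr => a _; rewrite !rmorphM !rmorph_mnmexp.
  congr (_ * _); first exact: phi_map.
  by apply: eq_bigr => i _; case: (hw i) => _ /= ->.
move=> /quotr_pi0P h0; apply/quotr_pi0P/(can_inj phiK).
rewrite [RHS]raddf0 phiE -[RHS](raddf0 pg); apply/quotr_eqP => m.
rewrite subr0 (rees_sumE _ _ _ _ (fun i => proj1 (hw i))).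
have /quotr_eqP/(_ m) : pg (\sum_(a <- r) rees_map A (c a) * mnmexp w a) = pg 0.
  by rewrite -phiE h0 !raddf0.
rewrite subr0 (rees_sumE _ _ _ _ (fun i => proj1 (hw i))).
have [me|me] := eqVneq (mdeg m) e.
  congr (ideal_pow _ _ _); apply: eq_bigl => a /=.
  by rewrite me eq_sym andbb.
rewrite [X in _ -> ideal_pow _ _ X]big_pred0 => [_|a]; first exact: ideal0.
by case: eqP => //= ->; exact/negbTE.
Qed.
End CanonicallyGraded.

(** * Forms of degree d - 1 orthogonal to the leading form *)

Lemma ms_ord_lead n (R : comPzRingType) e (s : mseries n R) : ms_ord n R e s ->
  ms_ord n R e.+1
    (s - \sum_(q : 'X_{1..n < e.+1} | mdeg q == e) ms_const n (s q) * msX R q).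
Proof.
move=> se m; rewrite ltnS => me; rewrite msBE.
have -> (P : pred 'X_{1..n < e.+1}) :
    (\sum_(q | P q) ms_const n (s q) * msX R q) m =
    \sum_(q | P q) s q * (m == q)%:R.
  elim/big_rec2: _ => [|q x y _ <-]; first exact: ms0E.
  by rewrite msDE [X in X + _]ms_const_mulE.
have [em|nm] := eqVneq (mdeg m) e; last first.
  rewrite se ?ltn_neqAle ?nm // big1 ?subr0 // => q /eqP qe.
  by case: (eqVneq m q) nm => [->|_ _]; rewrite ?qe ?eqxx ?mulr0.
have mb : (mdeg m < e.+1)%N by rewrite ltnS.
rewrite (bigD1 (BMultinom mb)) /= ?em // eqxx mulr1 big1 ?addr0 ?subrr //.
move=> q /andP[_]; rewrite bmeqP /= eq_sym => /negbTE ->.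
by rewrite mulr0.
Qed.

Section DegreeDrop.
Context (n d : nat) (k : fieldType) (f : dppoly n k).
Variables (r : seq 'X_{1..n}) (c : 'X_{1..n} -> k).
Hypotheses (d_neq0 : d%:R != 0 :> k) (fd : dp_le d.+1 f).
Hypothesis rd : {in r, forall a, mdeg a = d}.
(** That is, [X q * G i] pairs to zero with [f]. Where [a i = 0] the exponent [a - U_(i)] is
    truncated, but the multiplicity [a i] cancels the term. Degrees are shifted by one: the form has
    degree [d], and [f] degree at most [d.+1]. *)
Hypothesis orth : forall i q, mdeg q = 2%N ->
  \sum_(a <- r) c a * coeff (q + (a - U_(i)))%MM f *+ a i = 0.
Local Notation X := (@msX n k).
Local Notation C := (@ms_const n k).

Let P := \sum_(a <- r) C (c a) * X a.
(* [dP/dX_i] *)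
Let G i := \sum_(a <- r) C (c a) * (X (a - U_(i))%MM *+ a i).

(** Only the quadratic part of [Q] counts: the rest times [G i] has order at least [3 + (d - 1)],
    beyond the degree of [f]. *)
Lemma pair_orth Q i : ms_ord n k 2 Q -> pair f (Q * G i) = 0.
Proof.
move=> hQ; have hG : ms_ord n k d.-1 (G i).
  apply: ideal_sum => a /rd ad; apply: idealM.
  have [->|ai] := eqVneq (a i) 0%N; first by rewrite mulr0n; exact: ideal0.
  rewrite -mulr_natl; apply: idealM; have -> : d.-1 = mdeg (a - U_(i)).
    have ia : (U_(i) <= a)%MM by rewrite lep1mP.
    by rewrite -ad -{1}(submK ia) mdegD mdeg1 addn1.
  exact: ms_ordX.
set Q2 := \sum_(q : 'X_{1..n < 3} | mdeg q == 2) C (Q q) * X q.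
rewrite -(subrK Q2 Q) mulrDl raddfD /= (pair_ord fd) ?add0r; last first.
  apply: ms_ord_le (ms_ord_mul (ms_ord_lead hQ) hG).
  by case: (d) d_neq0 => //; rewrite eqxx.
rewrite /Q2 mulr_suml raddf_sum.
rewrite big1 //= => q /eqP q2.
rewrite -mulrA pairZ [msX k q * _]mulr_sumr raddf_sum /= -[RHS](mulr0 (Q q)).
rewrite -[X in _ = _ * X](orth i q2); congr (_ * _); apply: eq_bigr => a _.
by rewrite mulrCA pairZ mulrnAr -msXD raddfMn /= pairX mulrnAr.
Qed.

Lemma euler_sum : \sum_i X U_(i) * G i = P *+ d.
Proof.
under eq_bigr do rewrite mulr_sumr.
rewrite exchange_big /= -sumrMnl !big_seq; apply: eq_bigr => a /rd ad.
under eq_bigr do rewrite mulrCA.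
rewrite -mulr_sumr -mulrnAr; congr (_ * _).
rewrite -[in RHS]ad mdegE -sumrMnr; apply: eq_bigr => i _.
have [->|ai] := eqVneq (a i) 0%N; first by rewrite !mulr0n mulr0.
by rewrite mulrnAr -msXD addmC submK ?lep1mP.
Qed.

(** After multiplication by the invertible [d], Euler's formula writes [t * P] through the products
    [t * X U_(i) * G i], where [t * X U_(i)] has order two. So [P] contracts [f] to a constant. *)
Lemma pair_euler t : ms_ord n k 1 t -> pair f (t * P) = 0.
Proof.
move=> ht; apply: (mulfI d_neq0); rewrite mulr0 mulr_natl -raddfMn /= -mulrnAr.
rewrite -euler_sum mulr_sumr raddf_sum big1 //= => i _; rewrite mulrA.
apply: pair_orth; apply: (ms_ord_mul (e := 1) (e' := 1)) => //.
by rewrite -(mdeg1 i); exact: ms_ordX.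
Qed.

Lemma canonically_graded_pair b : mdeg b = d.+1 -> coeff b f != 0 ->
  canonically_graded f -> \sum_(a <- r) c a * coeff a f = 0.
Proof.
move=> bd fb [phi [[psi phiK psiK] phi_map]].
have f0 : f != 0 by apply: contraNneq fb => ->; rewrite coeff0.
have [H [hH hom]] := graded_relations fd f0 phiK psiK phi_map.
pose Q i := H i - X U_(i).
have HE a : mnmexp H a = mnmexp (fun i => X U_(i) + Q i) a.
  by apply: eq_bigr => i _; rewrite addrC subrK.
have Q2 i : ms_ord n k 2 (Q i) by exact: hH.
pose D a := taylor1 Q a; pose E a := mnmexp H a - X a - D a.
have HDE a : mnmexp H a = X a + (D a + E a) by rewrite /E; ring.
have hD a : ms_ord n k (mdeg a + 1) (D a) by exact: taylor1_ord.
have hE a : ms_ord n k (mdeg a + 2) (E a) by rewrite /E HE; exact: mnmexp_taylor1.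
have pairHb : pair f (mnmexp H b) = coeff b f.
  rewrite HDE raddfD /= pairX (pair_ord fd) ?addr0 //.
  by apply: idealD; [apply: ms_ord_le (hD b) | apply: ms_ord_le (hE b)];
    rewrite bd ?addn1 ?addn2.
set p := \sum_(a <- r) C (c a) * mnmexp H a.
set DD := \sum_(a <- r) C (c a) * D a.
set EE := \sum_(a <- r) C (c a) * E a.
have pE : p = P + (DD + EE).
  by rewrite -!big_split; apply: eq_bigr => a _; rewrite HDE !mulrDr.
have hDD : ms_ord n k d.+1 DD.
  by apply: ideal_sum => a /rd <-; apply: idealM; rewrite -addn1.
have hEE : ms_ord n k d.+2 EE.
  by apply: ideal_sum => a /rd <-; apply: idealM; rewrite -addn2.
(* The first-order Taylor term of the whole form is the sum of [Q i * G i], which orthogonality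
   kills. *)
have pairD : pair f DD = 0.
  have -> : DD = \sum_i Q i * G i.
    under [RHS]eq_bigr do rewrite mulr_sumr.
    rewrite exchange_big /=; apply: eq_bigr => a _; rewrite mulr_sumr.
    by apply: eq_bigr => i _; rewrite mulrCA.
  by rewrite raddf_sum big1 // => i _; exact: pair_orth.
have pairp : pair f p = \sum_(a <- r) c a * coeff a f.
  rewrite pE !raddfD /= pairD (pair_ord fd hEE) !addr0 raddf_sum.
  by apply: eq_bigr => a _; rewrite /= pairZ pairX.
rewrite -pairp; set mu := pair f p / coeff b f.
suff : mu = 0 by move/eqP; rewrite mulf_eq0 invr_eq0 (negbTE fb) orbF => /eqP.
(* At [t = 0] this is the choice of [mu]. For other [t] every summand pairs to zero: [P] by Euler's
   formula, the rest by order. *)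
have hann : ann f (p - C mu * mnmexp H b).
  apply/contract_eq0P => t.
  rewrite mulrBr raddfB /= mulrCA pairZ.
  have [->|t0] := eqVneq t 0%MM.
    by rewrite msX0 !mul1r pairHb divfK ?subrr.
  have ht : ms_ord n k 1 (X t).
    by apply: ms_ord_le (@ms_ordX _ _ t); rewrite lt0n mdeg_eq0.
  rewrite [pair f (X t * mnmexp H b)](pair_ord fd) ?mulr0 ?subr0; last first.
    rewrite -add1n; apply: ms_ord_mul => //; rewrite HDE; apply: idealD.
      by rewrite -bd; exact: ms_ordX.
    by apply: idealD; [apply: ms_ord_le (hD b) | apply: ms_ord_le (hE b)];
      rewrite bd leq_addr.
  rewrite pE mulrDr raddfD /= pair_euler // add0r (pair_ord fd) //.
  rewrite -add1n; apply: ms_ord_mul => //; apply: idealD => //.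
  exact: ms_ord_le hEE.
have bNr : b \notin r by apply/negP => /rd /eqP; rewrite bd -[X in _ == X]addn0 -addn1 eqn_add2l.
(* [graded_relations] takes a single coefficient family; [b] is not in [r], so overriding its value
   is safe. *)
pose c' a := if a == b then - mu else c a.
have /hom : ann f (\sum_(a <- b :: r) C (c' a) * mnmexp H a).
  rewrite big_cons /c' eqxx rmorphN mulNr addrC.
  suff -> : \sum_(a <- r) C (c' a) * mnmexp H a = p by [].
  rewrite /p !big_seq; apply: eq_bigr => a ar; rewrite /c'.
  by case: eqP ar bNr => // -> ->.
(* In degree [d.+1] only [- mu] times the monomial [b] in [H] survives, and its pairing with [f]
   forces [mu = 0]. *)
move=> /(_ d.+1); rewrite big_cons bd eqxx big_seq_cond big_pred0 ?addr0; last first.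
  move=> a; apply/negP => /andP[/rd -> /eqP/eqP].
  by rewrite -[X in X == _]addn0 -addn1 eqn_add2l.
move/contract_eq0P/(_ 0%MM); rewrite msX0 mul1r pairZ pairHb /c' eqxx.
by move=> /eqP; rewrite mulf_eq0 oppr_eq0 (negbTE fb) orbF => /eqP.
Qed.
End DegreeDrop.

(** * Counting, and lines in Zariski open sets *)

Lemma underdetermined_system (k : fieldType) (I J : finType) (M : I -> J -> k) :
  (#|J| < #|I|)%N ->
  exists2 c : I -> k, (exists i, c i != 0) & forall j, \sum_i c i * M i j = 0.
Proof.
move=> JI; pose B := \matrix_(i < #|I|, j < #|J|) M (enum_val i) (enum_val j).
have /rowV0Pn[v /sub_kermxP vB v0] : kermx B != 0.
  rewrite kermx_eq0 /row_free neq_ltn; apply/orP; left.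
  exact: leq_ltn_trans (rank_leq_col B) JI.
exists (fun i => v 0 (enum_rank i)).
  have [i vi] := rV0Pn _ v0.
  by exists (enum_val i); rewrite enum_valK.
move=> j; move/matrixP/(_ 0 (enum_rank j)): vB; rewrite !mxE => vB.
rewrite -[RHS]vB.
rewrite (reindex (@enum_val I predT)) /=; last first.
  by exists enum_rank => i _; [exact: enum_valK | exact: enum_rankK].
by apply: eq_bigr => i _; rewrite mxE enum_valK enum_rankK.
Qed.

(** Exponents of degree [e] correspond to tuples over ['I_e.+1] with sum [e], counted by
    [card_ord_partitions]. *)
Lemma card_mdeg n e : #|[set a : 'X_{1..n.+1 < e.+1} | mdeg a == e]| = 'C(n + e, n).
Proof.
rewrite -card_ord_partitions.
pose g (t : n.+1.-tuple 'I_e.+1) : 'X_{1..n.+1} := [multinom tnth t i : nat | i < n.+1].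
have gdeg (t : n.+1.-tuple _) : mdeg (g t) = (\sum_(i <- t) i)%N.
  by rewrite mdegE big_tuple; apply: eq_bigr => i _; rewrite mnmE.
pose h t : 'X_{1..n.+1 < e.+1} := insubd bm0 (g t).
have hg (t : n.+1.-tuple 'I_e.+1) : (\sum_(i <- t) i == e)%N -> bmnm (h t) = g t.
  by move=> te; rewrite /h insubdK // unfold_in gdeg (eqP te).
rewrite -[RHS](card_in_imset (f := h)).
  apply: eq_card => a; rewrite inE; apply/idP/imsetP => [ae|[t]].
    have ai i : (a i < e.+1)%N.
      by rewrite ltnS -[X in (_ <= X)%N](eqP ae) mdegE (bigD1 i) //= leq_addr.
    have ga : g [tuple Ordinal (ai i) | i < n.+1] = a.
      by apply/mnmP => i; rewrite mnmE tnth_mktuple.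
    exists [tuple Ordinal (ai i) | i < n.+1]; first by rewrite inE -gdeg ga.
    by apply: val_inj; rewrite /= hg // -gdeg ga.
  by rewrite inE => te ->; rewrite hg // gdeg.
move=> t u; rewrite !inE => te ue /(congr1 (@bmnm _ _)); rewrite !hg // => tu.
apply: eq_from_tnth => i; apply: val_inj.
by have := congr1 (fun m : 'X_{1..n.+1} => m i) tu; rewrite !mnmE.
Qed.

Section Lines.
Context (n d : nat) (k : closedFieldType) (U : dppoly n k -> Prop).
Hypothesis Uopen : zariski_open d U.

(** Restrict to the line a defining polynomial of [U] that is nonzero at [f]; the result [q] is
    nonzero because it is nonzero at [t = 0]. *)
Lemma zariski_open_line f b : U f -> (mdeg b <= d)%N ->
  exists2 q : {poly k}, q != 0 & forall t, q.[t] != 0 -> U (f + << t *g b >>).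
Proof.
have [E UE] := Uopen => /UE [fd [p Ep pf]] bd.
have bd1 : (mdeg b < d.+1)%N by [].
pose i0 := enum_rank (BMultinom bd1).
have coordE t : dp_coord (d := d) (f + << t *g b >>) =1
    fun i => dp_coord (d := d) f i + t * (i == i0)%:R.
  move=> i; rewrite /dp_coord coeffD coeffU; congr (_ + _ * _%:R).
  rewrite -(inj_eq enum_val_inj) enum_rankK bmeqP /= eq_sym //.
pose q := mmap (@polyC k) (fun i => (dp_coord (d := d) f i)%:P + 'X * ((i == i0)%:R)%:P) p.
have qE t : q.[t] = p.@[dp_coord (d := d) (f + << t *g b >>)].
  rewrite /q /mmap /meval /mmap -horner_evalE raddf_sum /=.
  apply: eq_bigr => m _; rewrite horner_evalE hornerM hornerC; congr (_ * _).
  rewrite /mmap1 -horner_evalE rmorph_prod; apply: eq_bigr => i _ /=.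
  by rewrite rmorphXn /= horner_evalE coordE !hornerE.
exists q => [|t].
  by apply: contraNneq pf => q0; have := qE 0; rewrite q0 horner0 freegU0 addr0 => <-.
rewrite qE => h; apply/UE; split; last by exists p.
move=> a; rewrite mem_dom coeffD coeffU; have [<-//|ba] := eqVneq b a.
by rewrite mulr0 addr0 -mem_dom; exact: fd.
Qed.
End Lines.

Lemma leq_bin2l_add m d e : (d <= e)%N -> ('C(m + d, m) <= 'C(m + e, m))%N.
Proof. by move=> de; apply: leq_bin2l; rewrite leq_add2l. Qed.

(** Here [m = n - 1] and [d] is the degree of the form, one less than that of the polynomial.
    Monotonicity in [d] reduces to [d = 4] for [m >= 6] and [d = 5] for [2 <= m < 6]; for [m = 1]
    the bound reads [6 < d + 1]. *)
Lemma bin_gt_quadrics m d : (1 <= m)%N -> (4 <= d)%N ->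
  (d = 4 -> 6 <= m)%N -> (d = 5 -> 2 <= m)%N ->
  (m.+1 * 'C(m + 2, m) < 'C(m + d, m))%N.
Proof.
move=> m1 d4 h4 h5.
have binE e : ('C(m + e, m) * e`! = (m + e) ^_ e)%N.
  by rewrite -bin_ffact -(bin_sub (leq_addr e m)) addKn.
have := binE 2%N; rewrite addn2 !ffactSS ffactn0 muln1 => b2.
have [m2|] := leqP 2 m; last first.
  case: m m1 {binE b2} h4 h5 => [//|[|//]] _ h4 h5 _.
  by rewrite !add1n !bin1; lia.
have [m6|m6] := leqP 6 m.
  apply: leq_trans (leq_bin2l_add _ d4).
  have := binE 4%N; rewrite addn4 !ffactSS ffactn0 muln1 => b4.
  (* The constant is [4! / 2!]; below, [60] is [5! / 2!]. *)
  have h : (12 * m.+1 * (m.+2 * m.+1) < m.+4 * m.+3 * (m.+2 * m.+1))%N.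
    by rewrite ltn_mul2r; apply/andP; split=> //; nia.
  have e2 : (m.+1 * 'C(m.+2, m) * 2 = m.+1 * (m.+2 * m.+1))%N by rewrite -mulnA b2.
  by change (4`!)%N with 24%N in b4; lia.
have d5 : (5 <= d)%N by lia.
apply: leq_trans (leq_bin2l_add _ d5).
have := binE 5%N; rewrite (addnS m 4) addn4 !ffactSS ffactn0 muln1 => b5.
have h : (60 * m.+1 * (m.+2 * m.+1) < m.+4.+1 * m.+4 * m.+3 * (m.+2 * m.+1))%N.
  by rewrite ltn_mul2r; apply/andP; split=> //; nia.
have e2 : (m.+1 * 'C(m.+2, m) * 2 = m.+1 * (m.+2 * m.+1))%N by rewrite -mulnA b2.
by change (5`!)%N with 120%N in b5; lia.
Qed.

(** * Failure of canonical gradedness outside the list *)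

Section GeneralPolynomial.
Context (k : closedFieldType) (n d : nat) (U : dppoly n k -> Prop).
Hypotheses (Uopen : zariski_open d U).

(* On a line through a point of [U], an affine function not identically zero and
   membership in [U] each exclude only finitely many points. *)
Lemma zariski_open_avoid f b (x y : k) : U f -> (mdeg b <= d)%N -> y != 0 ->
  exists2 t, U (f + << t *g b >>) & x + t * y != 0.
Proof.
move=> Uf bd y0; have [q q0 qU] := zariski_open_line Uopen Uf bd.
have l0 : x%:P + 'X * y%:P != 0.
  apply: contra_neq y0 => /(congr1 (fun p : {poly k} => p`_1)).
  by rewrite coefD coefC coefMC coefX add0r mul1r coef0.
have /closed_nonrootP[t] : q * (x%:P + 'X * y%:P) != 0 by rewrite mulf_neq0.
rewrite /root hornerM mulf_eq0 negb_or !hornerE => /andP[/qU Ut xy].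
by exists t.
Qed.

End GeneralPolynomial.

(** Two moves inside [U]: the first makes the leading form nonzero; the second changes only a
    coefficient of degree [d], so the linear system and its solution persist while the pairing
    becomes nonzero. *)
Lemma general_not_canonically_graded (k : closedFieldType) m d
    (U : dppoly m.+1 k -> Prop) :
  [pchar k] =i pred0 -> (0 < d)%N ->
  (m.+1 * 'C(m + 2, m) < 'C(m + d, m))%N ->
  zariski_open d.+1 U -> (exists f, U f) ->
  ~ (forall f, U f -> canonically_graded f).
Proof.
move=> k0 d0 count Uopen [f0 Uf0] cg.
pose b : 'X_{1..m.+1} := (U_(ord0) *+ d.+1)%MM.
have bd : mdeg b = d.+1 by rewrite mdegMn mdeg1 mul1n.
have bd1 : (mdeg b <= d.+1)%N by rewrite bd.
have [t Uf] := zariski_open_avoid Uopen (coeff b f0) Uf0 bd1 (oner_neq0 k).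
set f := f0 + _ in Uf *; rewrite mulr1 => fb.
have {}fb : coeff b f != 0 by rewrite coeffD coeffU eqxx mulr1.
pose I := {a : 'X_{1..m.+1 < d.+1} | a \in [set a : 'X_{1..m.+1 < d.+1} | mdeg a == d]}.
pose J := {a : 'X_{1..m.+1 < 3} | a \in [set a : 'X_{1..m.+1 < 3} | mdeg a == 2]}.
pose ex (a : I) : 'X_{1..m.+1} := bmnm (val a).
have exd a : mdeg (ex a) = d by have := valP a; rewrite inE => /eqP.
have ex_inj : injective ex by move=> a a' /val_inj/val_inj.
(* Unknowns are the coefficients of a form of degree [d]; equations are the orthogonality
   conditions, which involve only coefficients of [f] of degree [d.+1]. *)
pose M (a : I) (j : 'I_m.+1 * J) :=
  coeff (bmnm (val j.2) + (ex a - U_(j.1)))%MM f *+ ex a j.1.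
have card_lt : (#|{: 'I_m.+1 * J}| < #|{: I}|)%N.
  by rewrite card_prod !card_sig card_ord !card_mdeg.
have [c [a0 ca0] cM] := underdetermined_system M card_lt.
(* Extension of [c] by zero to all exponents. *)
pose c' a := \sum_(i : I | ex i == a) c i.
have c'E i : c' (ex i) = c i.
  by rewrite /c' (big_pred1 i) // => i'; rewrite (inj_eq ex_inj).
pose r := [seq ex i | i <- enum {: I}].
have sumr (F : 'X_{1..m.+1} -> k) : \sum_(a <- r) F a = \sum_i F (ex i).
  by rewrite big_map big_enum.
have a0d : (mdeg (ex a0) <= d.+1)%N by rewrite exd.
(* Moving along the monomial [ex a0] changes the pairing with the form at the nonzero rate
   [c a0]. *)
have [s Ug] :=
  zariski_open_avoid Uopen (\sum_(a <- r) c' a * coeff a f) Uf a0d ca0.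
set g := f + _ in Ug *; move/eqP; apply.
have gE a : mdeg a = d.+1 -> coeff a g = coeff a f.
  move=> ad; rewrite (coeffD _ f) coeffU; case: eqP => [ea|]; last by rewrite mulr0 addr0.
  by move: ad; rewrite -ea exd => /eqP; rewrite -[X in X == _]addn0 -addn1 eqn_add2l.
have -> : \sum_(a <- r) c' a * coeff a f + s * c a0 = \sum_(a <- r) c' a * coeff a g.
  rewrite !sumr.
  transitivity (\sum_i (c' (ex i) * coeff (ex i) f + c i * (s * (ex a0 == ex i)%:R))).
    rewrite big_split /=; congr (_ + _); rewrite (bigD1 a0) //= eqxx mulr1 mulrC.
    rewrite big1 ?addr0 // => i; rewrite (inj_eq ex_inj) eq_sym => /negbTE ->.
    by rewrite !mulr0.
  by apply: eq_bigr => i _; rewrite !c'E (coeffD _ f) coeffU mulrDr.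
have gd : dp_le d.+1 g by have [E UE] := Uopen; have [] := (UE g).1 Ug.
have dk : d%:R != 0 :> k by rewrite ((pcharf0P _).1 k0) -lt0n.
apply: (canonically_graded_pair dk gd _ _ bd); [| |by rewrite gE|exact: cg].
  by move=> a /mapP[i _ ->]; exact: exd.
move=> i q q2; rewrite sumr.
have qb : (mdeg q < 3)%N by rewrite q2.
have qS : BMultinom qb \in [set a : 'X_{1..m.+1 < 3} | mdeg a == 2] by rewrite inE /= q2.
rewrite -[RHS](cM (i, Sub (BMultinom qb) qS)); apply: eq_bigr => a _.
rewrite c'E /M /= mulrnAr; have [->|ai] := eqVneq (ex a i) 0%N; first by rewrite !mulr0n.
rewrite gE // mdegD q2; have ia : (U_(i) <= ex a)%MM by rewrite lep1mP.
by rewrite -(exd a) -{2}(submK ia) mdegD mdeg1 addn1 add2n.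
Qed.

Theorem proposition3p20 (k : closedFieldType) (k_char0 : [pchar k] =i pred0)
    (n d : nat) (n_ge1 : (1 <= n)%N) (d_ge1 : (1 <= d)%N)
    (general_graded : exists U : dppoly n k -> Prop,
      [/\ zariski_open d U, exists f, U f & forall f, U f -> canonically_graded f]) :
  [\/ (d <= 4)%N, d = 5%N /\ (n <= 6)%N, d = 6%N /\ n = 2%N | n = 1%N].
Proof.
have [U [Uopen Une cg]] := general_graded.
have [d4|d5] := leqP d 4; first by constructor 1.
have [n1|n1] := eqVneq n 1%N; first by constructor 4.
have [/andP[/eqP -> n6]|h5] := boolP ((d == 5%N) && (n <= 6)%N); first by constructor 2.
have [/andP[/eqP -> /eqP n2]|h6] := boolP ((d == 6%N) && (n == 2%N)); first by constructor 3.
exfalso; case: n n_ge1 n1 h5 h6 U Uopen Une cg {general_graded} => // m _ m1 h5 h6 U.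
(* From here [d] is the degree of the auxiliary form, and the polynomials have degree at most [d.+1]
   in [m.+1] variables. *)
case: d d_ge1 d5 h5 h6 => // d _ d4 h5 h6 Uopen Une.
apply: general_not_canonically_graded Uopen Une => //; first by lia.
by apply: bin_gt_quadrics => //; lia.
Qed.
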